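(* Let $m\ge3$ and let $\|\cdot\|$ be any norm on $\mathbb{R}^{2M_m}$, where $M_m=\frac{m(m-1)}2$. Let $A:(\mathbb{R}^m)^{3}\to\mathbb{R}^{2M_m}$ be the symmetric $3$-linear map given by the componentwise products $$A(v_1,v_2,v_3)_\tau=C_3(P_\tau v_1,P_\tau v_2,P_\tau v_3)\in\mathbb{R}^2,\qquad \tau\in T_m .$$ Then $$d(x_1,x_2,x_3)=\big\|A(x_2-x_1,\;x_3-x_1,\;x_3-x_2)\big\|,\qquad x_1,x_2,x_3\in\mathbb{R}^m,$$ defines a $3$-metric on $\mathbb{R}^m$.
   Context: $C_3:(\mathbb{R}^2)^3\to\mathbb{R}^2$ is the real $3$-linear map induced by complex multiplication: $C_3(w_1,w_2,w_3)=J^{-1}\big(J(w_1)J(w_2)J(w_3)\big)$, where $J:\mathbb{R}^2\to\mathbb{C}$, $J(a,b)=a+ib$. $T_m=\{\tau=(\tau_1,\tau_2)\in\{1,\ldots,m\}^2:\tau_1<\tau_2\}$, so $|T_m|=M_m$, and elements of $\mathbb{R}^{2M_m}$ are written as families of vectors in $\mathbb{R}^2$ indexed by $\tau\in T_m$. For $\tau\in T_m$, $P_\tau:\mathbb{R}^m\to\mathbb{R}^2$ is the projection $P_\tau(x)=(x_{\tau_1},x_{\tau_2})$ onto the coordinates $\tau_1,\tau_2$. Let $X$ be a set and $n\ge 2$. A map $d:X^n\to\mathbb{R}$ is a pseudo $n$-metric on $X$ if: (M1, semidefiniteness) if $x_i=x_j$ for some $i\ne j$, then $d(x_1,\ldots,x_n)=0$;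 (M2, symmetry) $d(x_{\pi(1)},\ldots,x_{\pi(n)})=d(x_1,\ldots,x_n)$ for all $x\in X^n$ and all permutations $\pi$ of $\{1,\ldots,n\}$; (M3, simplex inequality) $d(x_1,\ldots,x_n)\le\sum_{i=1}^n d(x_1,\ldots,x_{i-1},y,x_{i+1},\ldots,x_n)$ for all $x_1,\ldots,x_n,y\in X$. A pseudo $n$-metric is an $n$-metric if it is definite, i.e. $d(x_1,\ldots,x_n)=0$ implies $x_i=x_j$ for some $i\ne j$. A $3$-metric is an $n$-metric with $n=3$. *)

(* Defs.v *)
From HB Require Import structures.
From mathcomp Require Import all_boot all_order all_algebra.
From mathcomp Require Import perm complex reals ring.

Set Implicit Arguments.
Unset Strict Implicit.
Unset Printing Implicit Defensive.

Import Order.TTheory GRing.Theory Num.Theory.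
Local Open Scope ring_scope.

Record is_norm (R : realType) (V : lmodType R) (N : V -> R) : Prop := IsNorm {
  norm_ge0 : forall x, 0 <= N x;
  norm_definite : forall x, N x = 0 -> x = 0;
  norm_homogeneous : forall (a : R) x, N (a *: x) = `|a| * N x;
  norm_triangle : forall x y, N (x + y) <= N x + N y }.

Definition subst_at (X : Type) (n : nat) (x : {ffun 'I_n -> X}) (i : 'I_n)
    (y : X) : {ffun 'I_n -> X} :=
  [ffun j => if j == i then y else x j].

(* Only meant for 2 <= n; the definition itself makes no use of this bound. *)
Record pseudo_n_metric (R : realType) (X : Type) (n : nat)
    (d : {ffun 'I_n -> X} -> R) : Prop := PseudoNMetric {
  nmetric_semidefinite : forall (x : {ffun 'I_n -> X}) (i j : 'I_n),
    i != j -> x i = x j -> d x = 0;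
  nmetric_symmetric : forall (x : {ffun 'I_n -> X}) (s : {perm 'I_n}),
    d [ffun i => x (s i)] = d x;
  nmetric_simplex : forall (x : {ffun 'I_n -> X}) (y : X),
    d x <= \sum_(i < n) d (subst_at x i y) }.

Record n_metric (R : realType) (X : Type) (n : nat)
    (d : {ffun 'I_n -> X} -> R) : Prop := NMetric {
  nmetric_pseudo : pseudo_n_metric d;
  nmetric_definite : forall x : {ffun 'I_n -> X},
    d x = 0 -> exists i j : 'I_n, i != j /\ x i = x j }.

Definition J (R : realType) (w : 'rV[R]_2) : R[i] := Complex (w 0 0) (w 0 1).

Definition Jinv (R : realType) (z : R[i]) : 'rV[R]_2 :=
  \row_(k < 2) (if k == 0 then complex.Re z else complex.Im z).

Lemma JK (R : realType) : cancel (@J R) (@Jinv R).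
Proof.
move=> w; apply/rowP=> k; rewrite mxE; case: ifP => [/eqP-> //|k0] /=.
by congr (w 0 _); apply/val_inj; case: k k0 => [[|[|]]].
Qed.

Lemma JinvK (R : realType) : cancel (@Jinv R) (@J R).
Proof. by case=> a b; rewrite /J !mxE. Qed.

Definition C3 (R : realType) (w1 w2 w3 : 'rV[R]_2) : 'rV[R]_2 :=
  Jinv (J w1 * J w2 * J w3).

(* Coordinates are numbered from 0, as elements of 'I_m. *)
Definition T (m : nat) : finType := {t : 'I_m * 'I_m | (t.1 < t.2)%N}.

Definition M (m : nat) : nat := (m * (m - 1))./2.

Lemma card_T (m : nat) : #|T m| = M m.
Proof.
rewrite card_sig /M subn1 -bin2 -bin2_sum -sum1_card.
rewrite (eq_bigl (fun p : 'I_m * 'I_m => xpredT p.2 && (p.1 < p.2)%N)) //.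
rewrite big_mkcondr /=.
rewrite -(pair_bigA _ (fun i j : 'I_m => if (i < j)%N then 1%N else 0%N)) /=.
rewrite exchange_big big_mkord; apply: eq_bigr => j _ /=.
rewrite -big_mkcond sum1_card.
have widen_inj : injective (widen_ord (ltnW (ltn_ord j))).
  by move=> a b /(congr1 val) /= /val_inj.
rewrite -[RHS]card_ord -(card_imset _ widen_inj).
apply: eq_card => i; apply/idP/imsetP => [ij|[k _ ->]].
  by exists (Ordinal (ij : (i < j)%N)) => //; apply/val_inj.
exact: (ltn_ord k).
Qed.

Definition P (R : realType) (m : nat) (t : T m) (x : 'rV[R]_m) : 'rV[R]_2 :=
  \row_(k < 2) (if k == 0 then x 0 (val t).1 else x 0 (val t).2).

(* [{ffun T m -> 'rV[R]_2}], with its pointwise module structure, is the space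
   R^(2 * M m) written as families of vectors of R^2 indexed by [T m]. *)
Definition A (R : realType) (m : nat) (v1 v2 v3 : 'rV[R]_m) :
    {ffun T m -> 'rV[R]_2} :=
  [ffun t => C3 (P t v1) (P t v2) (P t v3)].

Lemma A_sym12 (R : realType) (m : nat) (v1 v2 v3 : 'rV[R]_m) :
  A v1 v2 v3 = A v2 v1 v3.
Proof. by apply/ffunP=> t; rewrite !ffunE /C3 [J _ * J (P t v2)]mulrC. Qed.

Lemma A_sym23 (R : realType) (m : nat) (v1 v2 v3 : 'rV[R]_m) :
  A v1 v2 v3 = A v1 v3 v2.
Proof. by apply/ffunP=> t; rewrite !ffunE /C3 mulrAC. Qed.

Lemma A_linear (R : realType) (m : nat) (v2 v3 : 'rV[R]_m) :
  linear (fun v1 => A v1 v2 v3).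
Proof.
move=> a u v; apply/ffunP=> t; rewrite !ffunE.
have PE i : P t (a *: u + v) 0 i = a * P t u 0 i + P t v 0 i.
  by rewrite !mxE; case: ifP.
by apply/rowP=> k; rewrite !mxE /=; case: ifP => _; rewrite !PE; ring.
Qed.

(* Main.v *)
(** In each component [t], identifying R^2 with the complex numbers, the map
    [vander] below is the Vandermonde determinant of the three points [P t x_i].
    It is alternating, and expanding the vanishing 4 x 4 determinant with rows
    1, 1, z, z^2 gives V(a,b,c) = V(y,b,c) + V(a,y,c) + V(a,b,y); the symmetry and
    the simplex inequality follow by applying the norm.  For definiteness, let
    u, v, w be the three differences and suppose A(u,v,w) = 0 and w_c <> 0.
    As w = v - u, one of u_c, v_c is nonzero, say u_c.  No projection of u or w
    onto a pair containing c vanishes, so all those of v do, whence v = 0. *)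
Require Import Defs.
From HB Require Import structures.
From mathcomp Require Import all_boot all_order all_algebra.
From mathcomp Require Import perm complex reals.
From mathcomp Require Import ring.

Set Implicit Arguments.
Unset Strict Implicit.
Unset Printing Implicit Defensive.

Import Order.TTheory GRing.Theory Num.Theory.
Local Open Scope ring_scope.

Definition vander (R : realType) (m : nat) (a b c : 'rV[R]_m) :=
  A (b - a) (c - a) (c - b).

Lemma norm0 (R : realType) (V : lmodType R) (N : V -> R) :
  is_norm N -> N 0 = 0.
Proof.
by move=> hN; rewrite -(scale0r (0 : V)) (norm_homogeneous hN) normr0 mul0r.
Qed.

Lemma normN (R : realType) (V : lmodType R) (N : V -> R) (x : V) :
  is_norm N -> N (- x) = N x.
Proof.
by move=> hN; rewrite -scaleN1r (norm_homogeneous hN) normrN1 mul1r.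
Qed.

Lemma J0 (R : realType) : J (0 : 'rV[R]_2) = 0.
Proof. by rewrite /J !mxE. Qed.

Lemma JD (R : realType) (w z : 'rV[R]_2) : J (w + z) = J w + J z.
Proof. by rewrite /J !mxE. Qed.

Lemma JN (R : realType) (w : 'rV[R]_2) : J (- w) = - J w.
Proof. by rewrite /J !mxE. Qed.

Lemma P_sub (R : realType) (m : nat) (t : T m) (x y : 'rV[R]_m) :
  P t (x - y) = P t x - P t y.
Proof. by apply/rowP=> k; rewrite !mxE; case: ifP. Qed.

(** As [J] is injective, identities between values of [vander] may be checked after applying [J],
    where they become polynomial identities in three complex numbers, within reach of [ring]. *)
Lemma J_vander (R : realType) (m : nat) (t : T m) (a b c : 'rV[R]_m) :
  J (vander a b c t) =
  (J (P t b) - J (P t a)) * (J (P t c) - J (P t a)) * (J (P t c) - J (P t b)).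
Proof. by rewrite !ffunE /C3 JinvK !P_sub !JD !JN. Qed.

Lemma vander_swap12 (R : realType) (m : nat) (a b c : 'rV[R]_m) :
  vander b a c = - vander a b c.
Proof.
apply/ffunP=> t; apply: (can_inj (@JK R)).
by rewrite [in RHS]ffunE JN !J_vander; ring.
Qed.

Lemma vander_swap23 (R : realType) (m : nat) (a b c : 'rV[R]_m) :
  vander a c b = - vander a b c.
Proof.
apply/ffunP=> t; apply: (can_inj (@JK R)).
by rewrite [in RHS]ffunE JN !J_vander; ring.
Qed.

Lemma vander_simplex (R : realType) (m : nat) (a b c y : 'rV[R]_m) :
  vander a b c = vander y b c + vander a y c + vander a b y.
Proof.
apply/ffunP=> t; apply: (can_inj (@JK R)).
(* Evaluates the sum at [t] while keeping [vander] folded, so that [J_vander] still applies. *)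
have ffunD (f g : {ffun T m -> 'rV[R]_2}) : (f + g) t = f t + g t.
  by rewrite ffunE.
by rewrite !ffunD !JD !J_vander; ring.
Qed.

Lemma vander_diag12 (R : realType) (m : nat) (a c : 'rV[R]_m) :
  vander a a c = 0.
Proof.
apply/ffunP=> t; apply: (can_inj (@JK R)).
by rewrite [in RHS]ffunE J0 J_vander; ring.
Qed.

Lemma vander_diag23 (R : realType) (m : nat) (a b : 'rV[R]_m) :
  vander a b b = 0.
Proof.
apply/ffunP=> t; apply: (can_inj (@JK R)).
by rewrite [in RHS]ffunE J0 J_vander; ring.
Qed.

Lemma vander_diag13 (R : realType) (m : nat) (a b : 'rV[R]_m) :
  vander a b a = 0.
Proof. by rewrite vander_swap23 vander_diag12 oppr0. Qed.

(** [J] is injective, sends 0 to 0 and turns [C3] into multiplication in a field, where there are no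
    zero divisors. *)
Lemma C3_eq0 (R : realType) (w1 w2 w3 : 'rV[R]_2) :
  C3 w1 w2 w3 = 0 -> [\/ w1 = 0, w2 = 0 | w3 = 0].
Proof.
move=> /(congr1 (@J R)); rewrite /C3 JinvK J0 => /eqP.
rewrite !mulf_eq0 -!J0 !(inj_eq (can_inj (@JK R))).
by case/orP=> [/orP[]|] /eqP->; [apply: Or31|apply: Or32|apply: Or33].
Qed.

Lemma P_eq0 (R : realType) (m : nat) (t : T m) (x : 'rV[R]_m) :
  P t x = 0 -> x 0 (val t).1 = 0 /\ x 0 (val t).2 = 0.
Proof. by move/rowP=> xt; move: (xt 0) (xt 1); rewrite !mxE. Qed.

Lemma A_eq0_pair (R : realType) (m : nat) (u v w : 'rV[R]_m) (i j : 'I_m) :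
  A u v w = 0 -> i != j ->
  [\/ u 0 i = 0 /\ u 0 j = 0, v 0 i = 0 /\ v 0 j = 0 | w 0 i = 0 /\ w 0 j = 0].
Proof.
(* [T m] contains only increasing pairs, but the conclusion is symmetric in [i] and [j]. *)
move=> A0; wlog ij : i j / (i < j)%N => [wl|_].
  rewrite neq_ltn => /orP[] ij; first by apply: wl => //; rewrite neq_ltn ij.
  have /wl := ij; rewrite neq_ltn ij => /(_ isT) [] [? ?].
  - exact: Or31.
  - exact: Or32.
  - exact: Or33.
pose t : T m := Sub (i, j) ij.
have /ffunP/(_ t) := A0; rewrite !ffunE => /C3_eq0[] /P_eq0 /= z.
- exact: Or31.
- exact: Or32.
- exact: Or33.
Qed.

Lemma A_eq0_mid (R : realType) (m : nat) (u v w : 'rV[R]_m) (c : 'I_m) :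
  (1 < m)%N -> A u v w = 0 -> u 0 c != 0 -> w 0 c != 0 -> v = 0.
Proof.
move=> m1 A0 uc wc.
have v0 j : j != c -> v 0 c = 0 /\ v 0 j = 0.
  rewrite eq_sym => cj; case: (A_eq0_pair A0 cj) => [] [z z'] //.
    by rewrite z eqxx in uc.
  by rewrite z eqxx in wc.
apply/rowP=> j; rewrite mxE; have [->|/v0[]//] := eqVneq j c.
(* The coordinate [c] itself is reached through any pair containing it; a second index exists
   because [1 < m]. *)
have [k kc] : exists k : 'I_m, k != c.
  have /card_gt0P[k kc] : (0 < #|predC1 c|)%N.
    by rewrite cardC1 card_ord -subn1 subn_gt0.
  by exists k.
by have [] := v0 k kc.
Qed.

Lemma vander_eq0 (R : realType) (m : nat) (a b c : 'rV[R]_m) :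
  (1 < m)%N -> vander a b c = 0 -> [\/ a = b, a = c | b = c].
Proof.
move=> m1 V0; have [->|cb] := eqVneq c b; first exact: Or33.
have [k wk] : exists k, (c - b) 0 k != 0.
  by apply/rV0Pn; rewrite subr_eq0.
(* If [b - a] vanishes at [k], then [c - a] agrees there with [c - b] and is nonzero; the symmetry
   of [A] puts [b - a] in the middle slot, whence [a = b]. Otherwise [c - a] is already in the
   middle, whence [a = c]. *)
have [uk|uk] := eqVneq ((b - a) 0 k) 0.
  have vk : (c - a) 0 k != 0.
    by move: wk uk; rewrite !mxE => wk /eqP; rewrite subr_eq0 => /eqP <-.
  move: V0; rewrite /vander A_sym12 => /(A_eq0_mid m1)/(_ vk wk)/eqP.
  by rewrite subr_eq0 eq_sym => /eqP; apply: Or31.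
by move: (A_eq0_mid m1 V0 uk wk) => /eqP; rewrite subr_eq0 eq_sym => /eqP; apply: Or32.
Qed.

Lemma I3_cases (i : 'I_3) : [\/ i = 0, i = 1 | i = 2].
Proof.
by case: i => [[|[|[|//]]] ?]; [apply: Or31|apply: Or32|apply: Or33]; apply/val_inj.
Qed.

(** Adjacent transpositions generate the symmetric group, and each only changes the sign of
    [vander], which the norm does not see. *)
Lemma norm_vander_perm (R : realType) (m : nat)
    (N : {ffun T m -> 'rV[R]_2} -> R) (x : 'I_3 -> 'rV[R]_m) (s : {perm 'I_3}) :
  is_norm N ->
  N (vander (x (s 0)) (x (s 1)) (x (s 2))) = N (vander (x 0) (x 1) (x 2)).
Proof.
move=> hN.
have swap12 a b c : N (vander b a c) = N (vander a b c).
  by rewrite vander_swap12 normN.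
have swap23 a b c : N (vander a c b) = N (vander a b c).
  by rewrite vander_swap23 normN.
have s01 : s 0 != s 1 by rewrite (inj_eq perm_inj).
have s02 : s 0 != s 2 by rewrite (inj_eq perm_inj).
have s12 : s 1 != s 2 by rewrite (inj_eq perm_inj).
move: s01 s02 s12.
case: (I3_cases (s 0)) => ->; case: (I3_cases (s 1)) => -> //;
  case: (I3_cases (s 2)) => -> // _ _ _.
(* What remains are the two 3-cycles and the exchange of 0 and 2. *)
- by rewrite swap23 swap12.
- by rewrite swap12 swap23.
- by rewrite swap12 swap23 swap12.
Qed.

Theorem proposition9 (R : realType) (m : nat) (hm : (3 <= m)%N)
    (N : {ffun T m -> 'rV[R]_2} -> R) (hN : is_norm N) :
  n_metric (fun x : {ffun 'I_3 -> 'rV[R]_m} =>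
    N (A (x 1 - x 0) (x 2 - x 0) (x 2 - x 1))).
Proof.
split; last first.
  move=> x /(norm_definite hN) /(vander_eq0 (ltnW hm)) [] e.
  - by exists 0, 1.
  - by exists 0, 2.
  - by exists 1, 2.
split.
- move=> x i j ij xij.
  suff -> : A (x 1 - x 0) (x 2 - x 0) (x 2 - x 1) = 0 by exact: norm0.
  rewrite -/(vander (x 0) (x 1) (x 2)).
  case: (I3_cases i) (I3_cases j) ij xij => -> [] -> // _ ->;
    by rewrite ?vander_diag12 ?vander_diag13 ?vander_diag23.
- by move=> x s; rewrite !ffunE; apply: norm_vander_perm.
- move=> x y; rewrite !big_ord_recl big_ord0 addr0 addrA.
  have -> : lift ord0 ord0 = 1 :> 'I_3 by apply/val_inj.
  have -> : lift ord0 (lift ord0 ord0) = 2 :> 'I_3 by apply/val_inj.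
  (* The three substituted triples give exactly the terms of [vander_simplex]; the triangle
     inequality is then used twice. *)
  rewrite !ffunE /= -!/(vander _ _ _) (vander_simplex _ _ _ y).
  by apply: le_trans (norm_triangle hN _ _) _; rewrite lerD2r; apply: norm_triangle.
Qed.
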